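(* Let $N \ge 2$ be an integer. If $(a_1, a_2, \ldots, a_N)$ is a cog in $\mathbb{R}^N$, then there exist real numbers $\{\theta_n\}_{n=0}^{N-1}$ such that for every $k \in \{1, 2, \ldots, N\}$, $$a_k = \frac{\sqrt{2}}{N} \sum_{n=0}^{N-1} \cos\left(\frac{2\pi n}{N}(k-1)+\theta_n\right).$$
   Context: For an integer $n$, let $(n)^*$ denote the unique element of $\{1,2,\ldots,N\}$ congruent to $n$ modulo $N$. The cyclic companions of a vector $(a_1,\ldots,a_N)\in\mathbb{R}^N$ are its cyclic shifts $\left(a_{(1+s)^*}, a_{(2+s)^*}, \ldots, a_{(N+s)^*}\right)$, $s\in\{1,\ldots,N-1\}$. A vector $(a_1,\ldots,a_N)\in\mathbb{R}^N$ is called a cyclic orthonormal generator (cog) in $\mathbb{R}^N$ if it together with its cyclic companions forms an orthonormal basis of $\mathbb{R}^N$ (standard inner product); equivalently, $\sum_{j=1}^{N} a_j a_{(j+s)^*} = \delta_0^s$ for every $s\in\{0,1,\ldots,N-1\}$, where $\delta_0^s = 1$ if $s=0$ and $0$ otherwise. *)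

(* Defs.v *)
From HB Require Import structures.
From mathcomp Require Import all_boot all_order all_algebra.
From mathcomp Require Import reals trigo.

Set Implicit Arguments.
Unset Strict Implicit.
Unset Printing Implicit Defensive.

Import Order.TTheory GRing.Theory Num.Theory.
Local Open Scope ring_scope.

(* Vectors are row vectors with 0-based coordinates: the entry a_k of
   (a_1, ..., a_N) is [a 0 i] with i = k - 1 in 'I_N. *)

Section StandardInnerProduct.
Variable R : realType.

Definition dotv n (u v : 'rV[R]_n) : R := \sum_(j < n) u 0 j * v 0 j.

Fact dotv_is_bilinear n :
  bilinear_for
    (GRing.Scale.Law.clone _ _ ( *%R ) _)
    (GRing.Scale.Law.clone _ _ (@idfun R \; *%R ) _)
    (@dotv n).
Proof.
split=> [v|u] c x y /=; rewrite /dotv mulr_sumr -big_split /=;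
  apply: eq_bigr => j _; rewrite !mxE.
- by rewrite mulrDl mulrA.
- by rewrite mulrDr mulrCA.
Qed.

HB.instance Definition _ n :=
  bilinear_isBilinear.Build R _ _ _
    (GRing.Scale.Law.clone _ _ ( *%R ) _)
    (GRing.Scale.Law.clone _ _ (@idfun R \; *%R ) _)
    (@dotv n) (dotv_is_bilinear n).

Fact dotv_is_symmetric n (u v : 'rV[R]_n) :
  dotv u v = (-1) ^+ false * idfun (dotv v u).
Proof.
by rewrite expr0 mul1r /=; apply: eq_bigr => j _; rewrite mulrC.
Qed.

HB.instance Definition _ n :=
  @isHermitianSesquilinear.Build R _ false idfun (@dotv n)
    (@dotv_is_symmetric n).

End StandardInnerProduct.

Fact shift_ord_subproof N (s : nat) (k : 'I_N) : ((k + s) %% N < N)%N.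
Proof. by rewrite ltn_pmod // (leq_ltn_trans _ (ltn_ord k)). Qed.

Definition shift_ord N (s : nat) (k : 'I_N) : 'I_N :=
  Ordinal (shift_ord_subproof s k).

Section Cog.
Variables (R : realType) (N : nat).
Implicit Type a : 'rV[R]_N.

Definition cyclic_shift a (s : nat) : 'rV[R]_N :=
  \row_(k < N) a 0 (shift_ord s k).

Definition cyclic_companions a : seq 'rV[R]_N :=
  [seq cyclic_shift a s | s <- iota 1 N.-1].

(* [orthonormal] and [basis_of] act on sequences, so repetitions among the N
   vectors are excluded. *)
Definition cog a : Prop :=
  orthonormal (@dotv R N) (a :: cyclic_companions a) /\
  basis_of {:'rV[R]_N} (a :: cyclic_companions a).

End Cog.

(* Main.v *)
(* Orthonormality of the cyclic shifts says that every discrete Fourier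
   coefficient C_n - i S_n of [a] has modulus 1, say exp(i phi_n).  Fourier
   inversion represents the real vector [a] by the exponentials
   exp(i (x + phi_n)) with x = 2 pi n k / N; the sum of their imaginary parts
   vanishes, so cos(x + phi_n) may be replaced by
   cos(x + phi_n) - sin(x + phi_n) = sqrt 2 * cos(x + phi_n + pi / 4),
   and theta_n = phi_n + pi / 4 works, that is,
   sqrt 2 * (cos theta_n, sin theta_n) = (C_n + S_n, C_n - S_n). *)

Require Import Defs.
From mathcomp Require Import all_boot all_order all_algebra.
From mathcomp Require Import reals trigo.
From mathcomp Require Import ring lra zify.

Set Implicit Arguments.
Unset Strict Implicit.
Unset Printing Implicit Defensive.

Import Order.TTheory GRing.Theory Num.Theory.
Local Open Scope ring_scope.

(** Moving the summation index by one changes neither sum, as [N%:R * z] is a whole number of turns.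
    The vector (C, S) is thus fixed by the rotation through [z], which is not the identity. *)
Lemma trig_sums_eq0 (R : realType) (z : R) (N : nat) :
    cos (N%:R * z) = 1 -> sin (N%:R * z) = 0 -> cos z != 1 ->
  \sum_(n < N) cos (n%:R * z) = 0 /\ \sum_(n < N) sin (n%:R * z) = 0.
Proof.
move=> cNz sNz z1.
set C := \sum_(n < N) cos _; set S := \sum_(n < N) sin _.
have nS n : n.+1%:R * z = n%:R * z + z by rewrite -natr1 mulrDl mul1r.
have shift (f : R -> R) : f (N%:R * z) = f 0 ->
    \sum_(n < N) f (n.+1%:R * z) = \sum_(n < N) f (n%:R * z).
  (* The sum of N + 1 terms is split at its first and at its last term, which agree by [fN]. *)
  move=> fN; have := erefl (\sum_(n < N.+1) f (n%:R * z)).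
  by rewrite {1}big_ord_recl big_ord_recr /= mul0r fN addrC => /addrI.
have eC : C = C * cos z - S * sin z.
  rewrite -[LHS]shift ?cos0 // !mulr_suml -sumrB.
  by apply: eq_bigr => n _; rewrite nS cosD.
have eS : S = S * cos z + C * sin z.
  rewrite -[LHS]shift ?sin0 // !mulr_suml -big_split.
  by apply: eq_bigr => n _; rewrite nS sinD.
have : (1 - cos z) * (C ^+ 2 + S ^+ 2) = 0.
  transitivity (C * (C - (C * cos z - S * sin z))
                + S * (S - (S * cos z + C * sin z))); first by ring.
  by rewrite -eC -eS !subrr !mulr0 addr0.
move/eqP; rewrite mulf_eq0 subr_eq0 eq_sym (negPf z1) /=.
by rewrite paddr_eq0 ?sqr_ge0 // !sqrf_eq0 => /andP[/eqP-> /eqP->].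
Qed.

(** Orthogonality of the characters of Z/N, in real and imaginary parts. *)
Lemma trig_sums_dft (R : realType) (N : nat) (k j : 'I_N) :
  let z := 2 * pi / N%:R * (k%:R - j%:R) : R in
  \sum_(n < N) cos (n%:R * z) = N%:R * (k == j)%:R /\
  \sum_(n < N) sin (n%:R * z) = 0.
Proof.
move=> z.
have N0 : N%:R != 0 :> R by rewrite pnatr_eq0 -lt0n (leq_ltn_trans _ (ltn_ord k)).
have [kj | kj] := eqVneq k j.
  rewrite /z kj subrr mulr0 mulr1.
  rewrite (eq_bigr (fun=> 1)) => [|n _]; last by rewrite mulr0 cos0.
  rewrite sumr_const card_ord; split=> //.
  by apply: big1 => n _; rewrite mulr0 sin0.
rewrite mulr0; apply: trig_sums_eq0.
- have -> : N%:R * z = pi *+ 2 *+ k - pi *+ 2 *+ j by rewrite /z; field.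
  by rewrite cosB -[pi *+ 2 *+ k]add0r -[pi *+ 2 *+ j]add0r
    !(periodicn (@cosD2pi R)) !(periodicn (@sinD2pi R)) cos0 sin0 mulr0 addr0 mulr1.
- have -> : N%:R * z = pi *+ 2 *+ k - pi *+ 2 *+ j by rewrite /z; field.
  by rewrite sinB -[pi *+ 2 *+ k]add0r -[pi *+ 2 *+ j]add0r
    !(periodicn (@cosD2pi R)) !(periodicn (@sinD2pi R)) cos0 sin0 mulr0 subr0 mul0r.
(* Since cos z = 1 - 2 sin^2 (z / 2), it suffices that the half angle has nonzero sine; for ordered
   indices it lies strictly between 0 and pi. *)
have half_pos (p q : 'I_N) : (p < q)%N ->
    sin (pi * ((q%:R - p%:R) / N%:R) : R) != 0.
  move=> pq; rewrite gt_eqF // sin_gt0_pi //.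
  have Np : 0 < N%:R :> R by rewrite lt0r N0 ler0n.
  rewrite mulr_gt0 ?pi_gt0 ?divr_gt0 ?subr_gt0 ?ltr_nat //=.
  rewrite gtr_pMr ?pi_gt0 // ltr_pdivrMr // mul1r.
  have : (q%:R < N%:R :> R) by rewrite ltr_nat.
  by have := ler0n R p; lra.
set h := pi * ((k%:R - j%:R) / N%:R) : R.
have -> : z = h *+ 2 by rewrite /z /h; field.
have h0 : sin h != 0.
  move: kj; rewrite -val_eqE neq_ltn => /orP[] /half_pos //.
  by rewrite /h -opprB mulNr mulrN sinN oppr_eq0.
rewrite cos_mulr2n cos2sin2 -subr_eq0.
have -> : (1 - sin h ^+ 2) *+ 2 - 1 - 1 = - 2 * sin h ^+ 2 by ring.
by rewrite mulf_neq0 ?expf_neq0 // oppr_eq0 pnatr_eq0.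
Qed.

Lemma cos_sin_exists (R : realType) (c s : R) :
  c ^+ 2 + s ^+ 2 = 1 -> exists t : R, cos t = c /\ sin t = s.
Proof.
move=> cs1.
have c1 : -1 <= c <= 1.
  by rewrite -ler_norml -(@expr_le1 _ 2) // real_normK ?num_real // -cs1
    lerDl sqr_ge0.
have cK : cos (acos c) = c by case: (acos_def c1).
have sK : sin (acos c) = `|s|.
  by rewrite sin_acos // -cs1 addrAC subrr add0r sqrtr_sqr.
have [s0 | s0] := leP 0 s.
  by exists (acos c); rewrite cK sK ger0_norm.
by exists (- acos c); rewrite cosN sinN cK sK ltr0_norm // opprK.
Qed.

Lemma shift_ord_injl (N : nat) (l : 'I_N) :
  injective (fun s : 'I_N => shift_ord s l).
Proof.
move=> s t /(congr1 val) /= /eqP; rewrite eqn_modDl !modn_small // => /eqP.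
exact: val_inj.
Qed.

Lemma cog_autocorrelation (R : realType) (N : nat) (a : 'rV[R]_N) (s : 'I_N) :
  cog a -> \sum_(l < N) a 0 l * a 0 (shift_ord s l) = (s == 0 :> nat)%:R.
Proof.
move=> [/andP[/= /andP[/eqP a1 _] /andP[/andP[orth _] _]] _].
(* Shift 0 is [a] itself, the head of the list; the companions start at shift 1. *)
have [s0 | s0] := eqVneq (s : nat) 0%N.
  rewrite -[RHS]a1; apply: eq_bigr => l _; congr (_ * a 0 _).
  by apply: val_inj; rewrite /= s0 addn0 modn_small.
have := allP orth (cyclic_shift a s) _.
rewrite map_f => [/(_ isT)/eqP as0|]; last first.
  by rewrite mem_iota; have := ltn_ord s; lia.
by rewrite -[RHS]as0; apply: eq_bigr => l _; rewrite mxE.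
Qed.

Lemma cos_shift_ord (R : realType) (N n : nat) (l s : 'I_N) :
  cos (n%:R * (2 * pi / N%:R * ((shift_ord s l)%:R - l%:R))) =
  cos (n%:R * (2 * pi / N%:R * s%:R)) :> R.
Proof.
have N0 : N%:R != 0 :> R by rewrite pnatr_eq0 -lt0n (leq_ltn_trans _ (ltn_ord l)).
(* Reducing l + s modulo N removes (l + s) %/ N periods, that is, n times as many full turns from
   the angle. *)
rewrite -[LHS](periodicn (@cosD2pi R) (n * ((l + s) %/ N))) /=; congr cos.
have := congr1 (fun m => m%:R : R) (divn_eq (l + s) N).
rewrite !natrD natrM => lsE.
have -> : s%:R = ((l + s) %/ N)%:R * N%:R + ((l + s) %% N)%:R - l%:R :> R.
  by rewrite -lsE addrAC subrr add0r.
by rewrite -[_ *+ (n * _)]mulr_natr natrM; field.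
Qed.

(** The power spectrum is the Fourier transform of the cyclic autocorrelation, here a delta at 0. *)
Lemma cog_spectrum (R : realType) (N n : nat) (a : 'rV[R]_N) :
    (0 < N)%N -> cog a ->
  let x (j : 'I_N) := n%:R * (2 * pi / N%:R * j%:R) : R in
  (\sum_(j < N) a 0 j * cos (x j)) ^+ 2 +
  (\sum_(j < N) a 0 j * sin (x j)) ^+ 2 = 1.
Proof.
move=> N0 cog_a x.
transitivity (\sum_(l < N) \sum_(j < N) a 0 l * a 0 j * cos (x j - x l)).
  rewrite !expr2 !mulr_suml -big_split; apply: eq_bigr => l _ /=.
  rewrite !mulr_sumr -big_split; apply: eq_bigr => j _ /=.
  by rewrite cosB; ring.
transitivity (\sum_(s < N) (s == 0 :> nat)%:R * cos (x s)).
  under [RHS]eq_bigr => s _ do rewrite -(cog_autocorrelation s cog_a) mulr_suml.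
  rewrite [RHS]exchange_big; apply: eq_bigr => l _ /=.
  (* For fixed l, the index j is written as l + s modulo N. *)
  rewrite (reindex_inj (@shift_ord_injl N l)); apply: eq_bigr => s _ /=.
  by rewrite /x -!mulrBr cos_shift_ord.
rewrite (bigD1 (Ordinal N0)) //= big1 => [|s]; last first.
  by rewrite -val_eqE /= => /negPf->; rewrite mul0r.
by rewrite /x /= !mulr0 cos0 mulr1 addr0.
Qed.

Theorem theorem1 (R : realType) (N : nat) (hN : (2 <= N)%N)
    (a : 'rV[R]_N) (ha : cog a) :
  exists theta : 'I_N -> R,
    forall k : 'I_N,
      a 0 k = Num.sqrt 2 / N%:R *
        \sum_(n < N) cos (2 * pi * n%:R / N%:R * k%:R + theta n).
Proof.
have N_gt0 : (0 < N)%N by exact: leq_trans hN.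
have N0 : N%:R != 0 :> R by rewrite pnatr_eq0 -lt0n.
pose x (n j : 'I_N) := n%:R * (2 * pi / N%:R * j%:R) : R.
pose C n := \sum_(j < N) a 0 j * cos (x n j).
pose S n := \sum_(j < N) a 0 j * sin (x n j).
have CS n : C n ^+ 2 + S n ^+ 2 = 1 by exact: cog_spectrum.
have r2 : Num.sqrt 2 ^+ 2 = 2 :> R by rewrite sqr_sqrtr ?ler0n.
have r0 : Num.sqrt 2 != 0 :> R by rewrite gt_eqF // sqrtr_gt0 ltr0n.
have /fin_all_exists [theta thetaE] n : exists t : R,
    cos t = (C n + S n) / Num.sqrt 2 /\ sin t = (C n - S n) / Num.sqrt 2.
  apply: cos_sin_exists; rewrite !expr_div_n r2 -[RHS](CS n).
  by field.
exists theta => k.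
(* Expanding [C n] and [S n] turns each term into a kernel in k - j, ready for summation over n. *)
have summand (n : 'I_N) : Num.sqrt 2 * cos (2 * pi * n%:R / N%:R * k%:R + theta n) =
    \sum_(j < N) a 0 j * (cos (n%:R * (2 * pi / N%:R * (k%:R - j%:R)))
                          - sin (n%:R * (2 * pi / N%:R * (k%:R - j%:R)))).
  have -> : 2 * pi * n%:R / N%:R * k%:R = x n k by rewrite /x; ring.
  have [cE sE] := thetaE n.
  transitivity (C n * (cos (x n k) - sin (x n k))
                + S n * (cos (x n k) + sin (x n k))).
    by rewrite cosD cE sE; field.
  rewrite !mulr_suml -big_split; apply: eq_bigr => j _ /=.
  by rewrite !mulrBr -/(x n k) -/(x n j) cosB sinB; ring.
rewrite mulrAC mulr_sumr; under eq_bigr => n _ do rewrite summand.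
(* After summing over n first, only j = k survives, with kernel sum N. *)
rewrite exchange_big (bigD1 k) //= [X in _ + X]big1 => [|j jk];
  rewrite -mulr_sumr sumrB.
  by have [-> ->] := trig_sums_dft R k k; rewrite eqxx mulr1; field.
have [-> ->] := trig_sums_dft R k j.
by rewrite eq_sym (negPf jk) mulr0 subr0 mulr0.
Qed.
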